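(* Let $(X,\mathcal{T})$ be an $L$-fuzzy topological space and $G\in L^X$. The following conditions are equivalent (a condition containing the parenthesized word ''(strong)'' may be read either with or without that word; all resulting conditions are equivalent): (1) $G$ is $L$-fuzzy SP-compact. (2) For any $a\in M(L)$, each strong $a$-remote family $\mathcal{P}\subseteq L^X$ of $G$ with $\bigwedge_{F\in\mathcal{P}}\mathcal{T}_{sp}^*(F)\not\leq a'$ has a finite subfamily $\mathcal{H}$ which is a (strong) $a$-remote family of $G$. (3) For any $a\in M(L)$ and each strong $a$-remote family $\mathcal{P}\subseteq L^X$ of $G$ with $\bigwedge_{F\in\mathcal{P}}\mathcal{T}_{sp}^*(F)\not\leq a'$, there exist a finite subfamily $\mathcal{H}$ of $\mathcal{P}$ and $b\in\beta^*(a)$ such that $\mathcal{H}$ is a (strong) $b$-remote family of $G$. (4) For any $a\in P(L)$, each strong $a$-shading $\mathcal{U}\subseteq L^X$ of $G$ with $\bigwedge_{F\in\mathcal{U}}\mathcal{T}_{sp}(F)\not\leq a$ has a finite subfamily $\mathcal{V}$ which is a (strong) $a$-shading of $G$. (5) For any $a\in P(L)$ and each strong $a$-shading $\mathcal{U}\subseteq L^X$ of $G$ with $\bigwedge_{F\in\mathcal{U}}\mathcal{T}_{sp}(F)\not\leq a$, there exist a finite subfamily $\mathcal{V}$ of $\mathcal{U}$ and $b\in\alpha^*(a)$ such that $\mathcal{V}$ is a (strong) $b$-shading of $G$. (6) For any $a\in M(L)$ and any $b\in\beta^*(a)$, each $Q_a$-cover $\mathcal{U}\subseteq L^X$ of $G$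 with $\mathcal{T}_{sp}(F)\geq a$ for each $F\in\mathcal{U}$ has a finite subfamily $\mathcal{V}$ which is a $Q_b$-cover of $G$. (7) For any $a\in M(L)$ and any $b\in\beta^*(a)$, each $Q_a$-cover $\mathcal{U}\subseteq L^X$ of $G$ with $\mathcal{T}_{sp}(F)\geq a$ for each $F\in\mathcal{U}$ has a finite subfamily $\mathcal{V}$ which is a (strong) $\beta_b$-cover of $G$.
   Context: $L$ is a completely distributive complete lattice with least element $\bot$, greatest element $\top$ and an order-reversing involution $'$ (a completely distributive De Morgan algebra). $X$ is a nonempty set; $L^X$ is the set of all $L$-subsets (maps $X\to L$), with pointwise order, joins, meets and complement $A'(x)=A(x)'$; $\underline{\bot},\underline{\top}$ are its least and greatest elements. An element $a\in L$ is prime if $a\ge b\wedge c$ implies $a\ge b$ or $a\ge c$, and co-prime if $a'$ is prime; $P(L)$ is the set of prime elements $\ne\top$, $M(L)$ the set of co-prime elements $\neq\bot$. In a complete lattice, $a\ll b$ means: for every subset $D$, $b\le\bigvee D$ implies $a\le d$ for some $d\in D$. $\beta(b)=\{a\in L: a\ll b\}$, $\beta^*(b)=\beta(b)\cap M(L)$, $\alpha(b)=\{a\in L: a'\ll b'\}$, $\alpha^*(b)=\alpha(b)\cap P(L)$. For $x\in X$, $\lambda\in M(L)$, $x_\lambda\in L^X$ is the $L$-fuzzy point with value $\lambda$ at $x$ and $\bot$ elsewhere; $x_\lambda\ll A$ refers to $\ll$ in $L^X$. An $L$-fuzzy topology on $X$ is a map $\mathcal{T}:L^X\to L$ with $\mathcal{T}(\underline\bot)=\mathcal{T}(\underline\top)=\top$,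 $\mathcal{T}(A\wedge B)\ge\mathcal{T}(A)\wedge\mathcal{T}(B)$, and $\mathcal{T}(\bigvee_i A_i)\ge\bigwedge_i\mathcal{T}(A_i)$; $(X,\mathcal{T})$ is an $L$-fuzzy topological space. The $L$-fuzzy preopen operator is $$\mathcal{T}_p(A)=\bigwedge_{x_\lambda\ll A}\ \bigvee_{B:\,x_\lambda\ll B}\Big\{\mathcal{T}(B)\wedge\bigwedge_{y_\mu\ll B}\ \bigwedge_{D:\,y_\mu\not\le D\ge A}(\mathcal{T}(D'))'\Big\},$$ and the $L$-fuzzy Semi-Preopen operator is $$\mathcal{T}_{sp}(A)=\bigvee_{B\le A}\Big\{\mathcal{T}_p(B)\wedge\bigwedge_{x_\lambda\ll A}\ \bigwedge_{D:\,x_\lambda\not\le D\ge B}(\mathcal{T}(D'))'\Big\},$$ where $B,D$ range over $L^X$. Put $\mathcal{T}_{sp}^*(A)=\mathcal{T}_{sp}(A')$. $2^{(\mathcal{P})}$ denotes the set of all finite subfamilies of $\mathcal{P}$. $G\in L^X$ is $L$-fuzzy SP-compact in $(X,\mathcal{T})$ if for every family $\mathcal{P}\subseteq L^X$, $$\bigwedge_{F\in\mathcal{P}}\mathcal{T}_{sp}(F)\wedge\bigwedge_{x\in X}\Big(G'(x)\vee\bigvee_{F\in\mathcal{P}}F(x)\Big)\le\bigvee_{\mathcal{Q}\in 2^{(\mathcal{P})}}\bigwedge_{x\in X}\Big(G'(x)\vee\bigvee_{F\in\mathcal{Q}}F(x)\Big).$$ For $a\in L$, $G\in L^X$ and a family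 $\mathcal{A}\subseteq L^X$, $\mathcal{A}$ is called: - an $a$-shading of $G$ if $G'(x)\vee\bigvee_{A\in\mathcal{A}}A(x)\not\le a$ for all $x\in X$; a strong $a$-shading of $G$ if $\bigwedge_{x\in X}(G'(x)\vee\bigvee_{A\in\mathcal{A}}A(x))\not\le a$; - an $a$-remote family of $G$ if $G(x)\wedge\bigwedge_{B\in\mathcal{A}}B(x)\not\ge a$ for all $x\in X$; a strong $a$-remote family of $G$ if $\bigvee_{x\in X}(G(x)\wedge\bigwedge_{B\in\mathcal{A}}B(x))\not\ge a$; - a $Q_a$-cover of $G$ if $G'(x)\vee\bigvee_{A\in\mathcal{A}}A(x)\ge a$ for all $x\in X$; - a $\beta_a$-cover of $G$ if $a\in\beta(G'(x)\vee\bigvee_{A\in\mathcal{A}}A(x))$ for all $x\in X$; a strong $\beta_a$-cover of $G$ if $a\in\beta\big(\bigwedge_{x\in X}(G'(x)\vee\bigvee_{A\in\mathcal{A}}A(x))\big)$. *)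

(* Defs.v *)
From HB Require Import structures.
From mathcomp Require Import all_boot all_order.
From mathcomp Require Import boolp classical_sets cardinality.

Set Implicit Arguments.
Unset Strict Implicit.
Unset Printing Implicit Defensive.

Import Order.TTheory.

(* order_scope is opened last: an unannotated `&` or `|` is a lattice
   operation, not a set operation. *)
Local Open Scope classical_set_scope.
Local Open Scope order_scope.

HB.mixin Record isCompleteLattice d T of Order.TBLattice d T := {
  supremums_neq0 : forall A : set T, supremums A !=set0
}.

#[short(type="completeLatticeType")]
HB.structure Definition CompleteLattice d :=
  { T of isCompleteLattice d T & Order.TBLattice d T }.

Section SupInf.
Context {d : Order.disp_t} {L : completeLatticeType d}.
Implicit Types (A : set L) (a b : L).

Definition csup A : L := supremum \bot A.
Definition cinf A : L := infimum \top A.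

Lemma csupP A : supremums A (csup A).
Proof.
rewrite /csup /supremum; case: ifPn => [/eqP ->|_].
  by split=> // a _; exact: le0x.
by case: xgetP => [a _ //|h]; have [a /h] := supremums_neq0 A.
Qed.

Lemma cinfP A : infimums A (cinf A).
Proof.
rewrite /cinf /infimum; case: ifPn => [/eqP ->|_].
  by split=> // a _; exact: lex1.
case: xgetP => [a _ //|h]; exfalso.
have [ubS lbS] := csupP (lbound A).
by apply: (h (csup (lbound A))); split=> // a Aa; apply: lbS => b; apply.
Qed.

Lemma csup_ub A a : A a -> a <= csup A.
Proof. by have [h _] := csupP A; exact: h. Qed.

Lemma csup_le A b : (forall a, A a -> a <= b) -> csup A <= b.
Proof. by have [_ h] := csupP A; exact: h. Qed.

Lemma cinf_lb A a : A a -> cinf A <= a.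
Proof. by have [h _] := cinfP A; exact: h. Qed.

Lemma cinf_ge A b : (forall a, A a -> b <= a) -> b <= cinf A.
Proof. by have [_ h] := cinfP A; exact: h. Qed.

End SupInf.

Reserved Notation "\csup_ ( i 'in' D ) F"
  (at level 41, F at level 41, i at level 0,
   format "'[' \csup_ ( i  'in'  D ) '/  '  F ']'").
Reserved Notation "\csup_ ( i : T ) F"
  (at level 41, F at level 41, i at level 0,
   format "'[' \csup_ ( i  :  T ) '/  '  F ']'").
Reserved Notation "\cinf_ ( i 'in' D ) F"
  (at level 41, F at level 41, i at level 0,
   format "'[' \cinf_ ( i  'in'  D ) '/  '  F ']'").
Reserved Notation "\cinf_ ( i : T ) F"
  (at level 41, F at level 41, i at level 0,
   format "'[' \cinf_ ( i  :  T ) '/  '  F ']'").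

Notation "\csup_ ( i 'in' D ) F" := (csup (image D (fun i => F))) : order_scope.
Notation "\csup_ ( i : T ) F" :=
  (csup (image setT (fun i : T => F))) : order_scope.
Notation "\cinf_ ( i 'in' D ) F" := (cinf (image D (fun i => F))) : order_scope.
Notation "\cinf_ ( i : T ) F" :=
  (cinf (image setT (fun i : T => F))) : order_scope.

HB.mixin Record hasNeg d T of Order.POrder d T := {
  neg : T -> T;
  negK : involutive neg;
  neg_anti : forall x y : T, x <= y -> neg y <= neg x
}.

#[short(type="negCompleteLatticeType")]
HB.structure Definition NegCompleteLattice d :=
  { T of hasNeg d T & CompleteLattice d T }.

HB.mixin Record isCompletelyDistributive d T of CompleteLattice d T := {
  cinf_csup_distr : forall (I : Type) (J : I -> Type) (a : forall i, J i -> T),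
    \cinf_(i : I) \csup_(j : J i) a i j =
    \csup_(f : (forall i, J i)) \cinf_(i : I) a i (f i)
}.

#[short(type="cdDeMorganType")]
HB.structure Definition CDDeMorgan d :=
  { T of isCompletelyDistributive d T & NegCompleteLattice d T }.

(* These instances extend the pointwise order on functions of boolp.FunOrder. *)
Section FunLattice.
Context {X : Type} {d : Order.disp_t} {L : completeLatticeType d}.

Lemma fun_le0x (f : X -> L) : ((fun=> \bot) : X -> L) <= f.
Proof. by apply/lefP => x; exact: le0x. Qed.

Lemma fun_lex1 (f : X -> L) : f <= ((fun=> \top) : X -> L).
Proof. by apply/lefP => x; exact: lex1. Qed.

HB.instance Definition _ :=
  Order.hasBottom.Build FunOrder.fun_display (X -> L) fun_le0x.
HB.instance Definition _ :=
  Order.hasTop.Build FunOrder.fun_display (X -> L) fun_lex1.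

Lemma fun_supremums_neq0 (A : set (X -> L)) : supremums A !=set0.
Proof.
exists (fun x => \csup_(f in A) f x); split=> [f Af|g ubg]; apply/lefP => x.
  by apply: csup_ub; exists f.
by apply: csup_le => _ [f Af <-]; have /lefP := ubg f Af; exact.
Qed.

HB.instance Definition _ :=
  isCompleteLattice.Build FunOrder.fun_display (X -> L) fun_supremums_neq0.

End FunLattice.

Section FunNeg.
Context {X : Type} {d : Order.disp_t} {L : negCompleteLatticeType d}.

Definition fun_neg (f : X -> L) : X -> L := fun x => neg (f x).

Lemma fun_negK : involutive fun_neg.
Proof. by move=> f; apply/funext => x; exact: negK. Qed.

Lemma fun_neg_anti (f g : X -> L) : f <= g -> fun_neg g <= fun_neg f.
Proof. by move=> /lefP fg; apply/lefP => x; exact/neg_anti/fg. Qed.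

HB.instance Definition _ :=
  hasNeg.Build FunOrder.fun_display (X -> L) fun_negK fun_neg_anti.

End FunNeg.

Section Below.
Context {d : Order.disp_t} {L : completeLatticeType d}.

(* [D] ranges over all subsets, including the empty one. *)
Definition below (a b : L) : Prop :=
  forall D : set L, b <= csup D -> exists2 c, D c & a <= c.

Definition is_prime (a : L) : Prop :=
  forall b c : L, b `&` c <= a -> b <= a \/ c <= a.

End Below.

Notation "a ≪ b" := (below a b) (at level 70, no associativity) : order_scope.

Section Primes.
Context {d : Order.disp_t} {L : negCompleteLatticeType d}.

Definition is_coprime (a : L) : Prop := is_prime (neg a).

Definition PL : set L := [set a | is_prime a /\ a != \top].
Definition ML : set L := [set a | is_coprime a /\ a != \bot].

Definition beta (b : L) : set L := [set a | a ≪ b].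
Definition beta_star (b : L) : set L := (beta b `&` ML)%classic.
Definition alpha (b : L) : set L := [set a | neg a ≪ neg b].
Definition alpha_star (b : L) : set L := (alpha b `&` PL)%classic.

End Primes.

Section Topology.
Context {d : Order.disp_t} {L : negCompleteLatticeType d} {X : Type}.

Definition fuzzy_point (x : X) (lam : L) : X -> L :=
  fun y => if `[< y = x >] then lam else \bot.

(* Meets and joins over the fuzzy points x_lam ≪ A are indexed by the function
   x_lam itself; here ≪ is the relation of the complete lattice X -> L. *)
Definition points_below (A : X -> L) : set (X -> L) :=
  [set e | (exists (x : X) (lam : L), ML lam /\ e = fuzzy_point x lam)
           /\ e ≪ A].

Record fuzzy_topology (T : (X -> L) -> L) : Prop := FuzzyTopology {
  fuzzy_topology_bot : T \bot = \top;
  fuzzy_topology_top : T \top = \top;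
  fuzzy_topology_meet : forall A B : X -> L, T A `&` T B <= T (A `&` B);
  fuzzy_topology_csup : forall (I : Type) (A : I -> X -> L),
    \cinf_(i : I) T (A i) <= T (\csup_(i : I) A i)
}.

Variable T : (X -> L) -> L.

Definition preopen (A : X -> L) : L :=
  \cinf_(e in points_below A) \csup_(B in [set B : X -> L | e ≪ B])
    (T B `&` \cinf_(z in points_below B)
               \cinf_(D in [set D : X -> L | ~~ (z <= D) /\ A <= D])
                 neg (T (neg D))).

Definition semi_preopen (A : X -> L) : L :=
  \csup_(B in [set B : X -> L | B <= A])
    (preopen B `&` \cinf_(e in points_below A)
                     \cinf_(D in [set D : X -> L | ~~ (e <= D) /\ B <= D])
                       neg (T (neg D))).

Definition semi_preclosed (A : X -> L) : L := semi_preopen (neg A).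

End Topology.

Section Compactness.
Context {d : Order.disp_t} {L : negCompleteLatticeType d} {X : Type}.
Implicit Types (G : X -> L) (A P Q : set (X -> L)) (a : L).

Definition cover_degree G A (x : X) : L := neg (G x) `|` \csup_(F in A) F x.
Definition remote_degree G A (x : X) : L := G x `&` \cinf_(F in A) F x.

Definition shading a G A : Prop := forall x, ~~ (cover_degree G A x <= a).
Definition strong_shading a G A : Prop :=
  ~~ (\cinf_(x : X) cover_degree G A x <= a).

Definition remote_family a G A : Prop := forall x, ~~ (a <= remote_degree G A x).
Definition strong_remote_family a G A : Prop :=
  ~~ (a <= \csup_(x : X) remote_degree G A x).

Definition Q_cover a G A : Prop := forall x, a <= cover_degree G A x.

Definition beta_cover a G A : Prop := forall x, beta (cover_degree G A x) a.
Definition strong_beta_cover a G A : Prop :=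
  beta (\cinf_(x : X) cover_degree G A x) a.

Definition finite_subfamilies P : set (set (X -> L)) :=
  [set Q | finite_set Q /\ (Q `<=` P)%classic].

Definition SP_compact (T : (X -> L) -> L) G : Prop :=
  forall P,
    (\cinf_(F in P) semi_preopen T F) `&` (\cinf_(x : X) cover_degree G P x)
    <= \csup_(Q in finite_subfamilies P) \cinf_(x : X) cover_degree G Q x.

End Compactness.

(* Main.v *)
(* In a completely distributive lattice every [u] is the join of the elements
   well below it.  If [u] is not below [a], iterating this gives a chain
   [... ≪ e 2 ≪ e 1 ≪ e 0 = u] that avoids the down-set of [a]; the elements
   above no [e n] are closed under all joins, and their greatest element is a
   prime above [a] but not above [u].  So the coprime elements in [beta u]
   already join to [u], and dually the primes in [alpha a] meet to [a].  This
   lets one pass between [a] and a nearby [b] in either direction, which absorbs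
   the difference between pointwise and strong conditions, and compares the
   SP-compactness inequality with its instances at primes or coprimes.  The
   remote family conditions are the images of the shading conditions under the
   involution. *)
Require Import Defs.
From mathcomp Require Import all_boot all_order.
From mathcomp Require Import boolp classical_sets cardinality.

Import Order.TTheory.

Local Open Scope classical_set_scope.
Local Open Scope order_scope.

(** * Order properties of the well-below relation *)

Section Below.
Context {d : Order.disp_t} {L : completeLatticeType d}.
Implicit Types a b c : L.

Lemma below_le {a b} : a ≪ b -> a <= b.
Proof.
by move=> ab; have [|c ->] := ab [set b]; first exact: csup_ub.
Qed.

Lemma below_le_trans {a b c} : a ≪ b -> b <= c -> a ≪ c.
Proof. by move=> ab bc D cD; apply: ab; exact: le_trans cD. Qed.

Lemma le_below_trans {a b c} : a <= b -> b ≪ c -> a ≪ c.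
Proof.
by move=> ab bc D /bc[e De be]; exists e => //; exact: le_trans be.
Qed.

End Below.

(** * De Morgan laws for the involution *)

Section Neg.
Context {d : Order.disp_t} {L : negCompleteLatticeType d}.
Implicit Types a b : L.

Lemma le_neg a b : (neg a <= neg b) = (b <= a).
Proof. by apply/idP/idP => /neg_anti //; rewrite !negK. Qed.

Lemma neg_lel a b : (neg a <= b) = (neg b <= a).
Proof. by rewrite -{1}(negK b) le_neg. Qed.

Lemma neg_ler a b : (a <= neg b) = (b <= neg a).
Proof. by rewrite -{1}(negK a) le_neg. Qed.

Lemma neg_meet a b : neg (a `&` b) = neg a `|` neg b.
Proof.
apply: le_anti; rewrite neg_lel lexI (neg_lel _ a) (neg_lel _ b) leUl leUr /=.
by rewrite leUx !le_neg leIl leIr.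
Qed.

Lemma neg_csup (A : set L) : neg (csup A) = cinf (neg @` A).
Proof.
apply: le_anti; apply/andP; split.
  by apply: cinf_ge => _ [a Aa <-]; rewrite le_neg; exact: csup_ub.
rewrite neg_ler; apply: csup_le => a Aa; rewrite neg_ler.
by apply: cinf_lb; exists a.
Qed.

Lemma neg_cinf (A : set L) : neg (cinf A) = csup (neg @` A).
Proof.
apply: le_anti; apply/andP; split.
  rewrite neg_lel; apply: cinf_ge => a Aa; rewrite neg_lel.
  by apply: csup_ub; exists a.
by apply: csup_le => _ [a Aa <-]; rewrite le_neg; exact: cinf_lb.
Qed.

Lemma neg_eq1 a : (neg a == \top) = (a == \bot).
Proof.
have -> : \bot = neg \top :> L by apply: le_anti; rewrite le0x neg_lel lex1.
by rewrite -[in RHS](negK a) (inj_eq (can_inj negK)).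
Qed.

Lemma PL_neg a : PL (neg a) <-> ML a.
Proof. by rewrite /PL /ML /= neg_eq1. Qed.

Lemma alpha_star_neg a b : alpha_star (neg a) (neg b) <-> beta_star a b.
Proof. by split=> -[ab /PL_neg Mb]; split=> //; move: ab; rewrite /alpha /= !negK. Qed.

(** This is the definition of [neg b ≪ neg a] read through the involution, which turns joins into
    meets. *)
Lemma alpha_cinf_le a b (A : set L) :
  alpha a b -> cinf A <= a -> exists2 c, A c & c <= b.
Proof.
move=> ab; rewrite -le_neg neg_cinf => /ab[_ [c Ac <-]].
by rewrite le_neg => cb; exists c.
Qed.

End Neg.

(** * Separation by primes and coprimes under complete distributivity *)

Section Approximation.
Context {d : Order.disp_t} {L : cdDeMorganType d}.
Implicit Types a u : L.

(** Complete distributivity is applied to the family of all [D] with [u <= csup D]. The meet of the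
    values of a choice function is below a member of each such [D], hence well below [u]; were all
    these meets below [a], so would be [u]. *)
Lemma nle_below {u a} : ~~ (u <= a) -> exists2 e, e ≪ u & ~~ (e <= a).
Proof.
move=> ua; apply: contrapT => noe; case/negP: ua.
pose I := {D : set L | u <= csup D}; pose J (i : I) := {c : L | sval i c}.
have uinf : u <= \cinf_(i : I) \csup_(j : J i) sval j.
  apply: cinf_ge => _ [i _ <-]; apply: (le_trans (svalP i)).
  by apply: csup_le => c ic; apply: csup_ub; exists (exist _ c ic).
apply: (le_trans uinf); rewrite cinf_csup_distr; apply: csup_le => _ [f _ <-].
apply: contrapT => /negP fa; apply: noe; eexists; last exact: fa.
move=> D uD; pose i : I := exist _ D uD.
by exists (sval (f i)); [exact: svalP (f i) | apply: cinf_lb; exists i].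
Qed.

Lemma nle_prime {u a} :
  ~~ (u <= a) -> exists p, [/\ PL p, a <= p & ~~ (u <= p)].
Proof.
move=> ua.
have /choice[next nextP] : forall e : L,
    exists e' : L, ~~ (e <= a) -> e' ≪ e /\ ~~ (e' <= a).
  move=> e; have [/nle_below[e' e'e e'a]|_] := boolP (~~ (e <= a)).
    by exists e'.
  (* Below [a] nothing is asked of [next], so any value serves. *)
  by exists \bot.
pose e n := iter n next u.
have eNa n : ~~ (e n <= a) by elim: n => //= n /nextP[].
have e_below n : e n.+1 ≪ e n by have [] := nextP _ (eNa n).
have e_anti m n : e (m + n)%N <= e m.
  elim: n => [|n IHn]; first by rewrite addn0.
  by rewrite addnS; exact: le_trans (below_le (e_below _)) IHn.
pose N := [set x | forall n, ~~ (e n <= x)].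
(* If [e n <= csup N], then [e n.+1 ≪ e n] puts [e n.+1] below a member of [N], which is absurd. So
   [csup N] lies in [N]. *)
have NP x : x <= csup N <-> N x.
  split=> [xN n|Nx]; last exact: csup_ub.
  apply/negP => /le_trans/(_ xN)/e_below[y Ny].
  by have /negP := Ny n.+1.
have NNP x : ~~ (x <= csup N) -> exists n, e n <= x.
  move=> xN; apply: contrapT => noe; case/negP: xN; apply/NP => n.
  by apply/negP => enx; apply: noe; exists n.
exists (csup N); split.
(* If [e m <= y] and [e n <= z], the common later term [e (m + n)] is below the meet of [y] and
   [z]. *)
- split=> [y z yz|].
    apply: contrapT => /not_orP[/negP/NNP[m ey] /negP/NNP[n ez]].
    have /negP := (NP _).1 yz (m + n)%N; apply; rewrite lexI.
    by rewrite (le_trans (e_anti m n) ey) addnC (le_trans (e_anti n m) ez).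
  apply/eqP => Ntop; have /NP/(_ 0%N) : \top <= csup N by rewrite Ntop.
  by rewrite lex1.
- exact/NP.
- by apply/negP => /NP/(_ 0%N); rewrite lexx.
Qed.

(** Take [e ≪ u] not below [a], and a prime [p] above [neg e] but not above [neg a]. The coprime is
    [neg p], and [neg p <= e] makes it well below [u]. *)
Lemma nle_beta_star {u a} : ~~ (u <= a) -> exists2 m, beta_star u m & ~~ (m <= a).
Proof.
move=> /nle_below[e eu]; rewrite -le_neg => /nle_prime[p [Pp ep ap]].
exists (neg p); last by rewrite neg_lel.
split; last by apply/PL_neg; rewrite negK.
by apply: (le_below_trans _ eu); rewrite neg_lel.
Qed.

Lemma nle_alpha_star {u a} : ~~ (u <= a) -> exists2 p, alpha_star a p & ~~ (u <= p).
Proof.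
rewrite -le_neg => /nle_beta_star[m am ma]; exists (neg m).
  by rewrite -(negK a); exact/alpha_star_neg.
by rewrite neg_ler.
Qed.

Lemma beta_star_le u v : (forall m, beta_star u m -> m <= v) -> u <= v.
Proof.
by move=> uv; apply: contrapT => /negP/nle_beta_star[m /uv ->].
Qed.

(** Approximating [a] by coprimes, and each of these by coprimes again, gives [a <= csup D]; then
    [b ≪ a] yields a member of [D] above [b]. *)
Lemma beta_star_interpolation a b :
  beta a b -> exists2 e, beta_star a e & beta e b.
Proof.
move=> ba; pose D := [set f : L | exists2 e, beta_star a e & f ≪ e].
have [|f [e ae fe] bf] := ba D; last by exists e => //; exact: le_below_trans fe.
apply: beta_star_le => e ae; apply: beta_star_le => f [fe _].
by apply: csup_ub; exists e.
Qed.

End Approximation.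

(** * Shadings, remote families and covers *)

Section Shadings.
Context {d : Order.disp_t} {L : cdDeMorganType d} {X : Type}.
Variable G : X -> L.
Implicit Types (a b : L) (P U V : set (X -> L)).

Definition cover_inf U : L := \cinf_(x : X) cover_degree G U x.

Lemma strong_shadingW a U : strong_shading a G U -> shading a G U.
Proof.
move=> Ua x; apply: contra Ua; apply: le_trans.
by apply: cinf_lb; exists x.
Qed.

(** If the meet of the cover degrees were below [a], then [alpha a b] would put a single one of them
    below [b]. *)
Lemma alpha_shading a b U : alpha a b -> shading b G U -> strong_shading a G U.
Proof.
move=> ab Ub; apply/negP => /(alpha_cinf_le _ _ _ ab)[_ [x _ <-]].
exact/negP.
Qed.

Lemma remote_shading a P :
  remote_family a G P <-> shading (neg a) G (neg @` P).
Proof.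
suff E x : (cover_degree G (neg @` P) x <= neg a) = (a <= remote_degree G P x).
  by split=> h x; move: (h x); rewrite E.
by rewrite -(le_neg (remote_degree _ _ _)) /remote_degree neg_meet neg_cinf /cover_degree !image_comp.
Qed.

Lemma strong_remote_shading a P :
  strong_remote_family a G P <-> strong_shading (neg a) G (neg @` P).
Proof.
rewrite /strong_remote_family /strong_shading -le_neg neg_csup image_comp.
suff -> : neg \o remote_degree G P = cover_degree G (neg @` P) by [].
apply/funext => x /=.
by rewrite /remote_degree neg_meet neg_cinf /cover_degree !image_comp.
Qed.

Lemma finite_subfamilies_neg P V :
  finite_subfamilies P V -> finite_subfamilies (neg @` P) (neg @` V).
Proof.
by move=> [finV VP]; split; [exact: finite_image | exact: image_subset].
Qed.

Lemma neg_imageK P : neg @` (neg @` P) = P.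
Proof.
by rewrite image_comp (_ : neg \o neg = id) ?image_id //; exact/funext/negK.
Qed.

Variable tau : (X -> L) -> L.

(** [W] is the property asked of the finite subfamily, so that the shading conditions differ only in
    [W]; [tau] stands for [semi_preopen T]. *)
Definition shading_reduction (W : L -> set (X -> L) -> Prop) : Prop :=
  forall a, PL a -> forall U, strong_shading a G U ->
    ~~ (\cinf_(F in U) tau F <= a) ->
    exists2 V, finite_subfamilies U V & W a V.

Definition remote_reduction (W : L -> set (X -> L) -> Prop) : Prop :=
  forall a, ML a -> forall P, strong_remote_family a G P ->
    ~~ (\cinf_(F in P) tau (neg F) <= neg a) ->
    exists2 H, finite_subfamilies P H & W a H.

(** Complementing every member is an involution on families that respects finite subfamilies, so the
    hypotheses and conclusions at [a] carry over to [neg a]. *)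
Lemma remote_shading_reduction (W W' : L -> set (X -> L) -> Prop) :
  (forall a P, W a P <-> W' (neg a) (neg @` P)) ->
  remote_reduction W <-> shading_reduction W'.
Proof.
move=> WW'; split=> [red a Pa U Ua taua|red a Ma P Pa taua].
  have [| | |H fH WH] := red (neg a) _ (neg @` U).
  - by apply/PL_neg; rewrite negK.
  - by apply/strong_remote_shading; rewrite negK neg_imageK.
  - by rewrite negK -[image _ _](image_comp neg tau) neg_imageK.
  exists (neg @` H); first by rewrite -(neg_imageK U); exact: finite_subfamilies_neg.
  by rewrite -(negK a); exact/WW'.
have [| | |V fV WV] := red (neg a) _ (neg @` P).
- exact/PL_neg.
- exact/strong_remote_shading.
- by rewrite image_comp.
exists (neg @` V); first by rewrite -(neg_imageK P); exact: finite_subfamilies_neg.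
by apply/WW'; rewrite neg_imageK.
Qed.

Lemma shading_reduction_sub (W W' : L -> set (X -> L) -> Prop) :
  (forall a V, W a V -> W' a V) -> shading_reduction W -> shading_reduction W'.
Proof.
by move=> WW' red a Pa U Ua /(red _ Pa _ Ua)[V fV WV]; exists V => //; exact: WW'.
Qed.

(** Since [a] is prime, the two non-inequalities at [a] merge into one for a meet, and a single [b]
    in [alpha_star a] preserves both. The reduction is then used at [b]. *)
Lemma shading_reduction_alpha (W : L -> set (X -> L) -> Prop) :
  shading_reduction W ->
  shading_reduction (fun a V => exists2 b, alpha_star a b & W b V).
Proof.
move=> red a [prime_a a1] U Ua taua.
have /nle_alpha_star[b ab] :
    ~~ ((\cinf_(F in U) tau F) `&` cover_inf U <= a).
  by apply/negP => /prime_a[]; exact/negP.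
move=> nb; have [| | |V fV WV] := red b _ U.
- by case: ab.
- by apply: contra nb => /(le_trans _); apply; exact: leIr.
- by apply: contra nb => /(le_trans _); apply; exact: leIl.
by exists V => //; exists b.
Qed.

Lemma shading_reduction_alpha_strong :
  shading_reduction
    (fun a V => exists2 b, alpha_star a b & shading b G V) ->
  shading_reduction (fun a => strong_shading a G).
Proof.
by apply: shading_reduction_sub => a V [b [ab _]]; exact: alpha_shading.
Qed.

Lemma shading_reduction_strong :
  shading_reduction (fun a => shading a G) ->
  shading_reduction (fun a => strong_shading a G).
Proof.
by move=> /shading_reduction_alpha/shading_reduction_alpha_strong.
Qed.

Definition compact_for : Prop :=
  forall P, (\cinf_(F in P) tau F) `&` cover_inf P
    <= \csup_(Q in finite_subfamilies P) cover_inf Q.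

(** Primality of [a] splits the meet on the left of the inequality. Conversely, a failure of the
    inequality gives a prime above its right side but not above its left side, and the reduction at
    that prime is contradictory. *)
Lemma compact_shading_reduction :
  compact_for <-> shading_reduction (fun a => strong_shading a G).
Proof.
split=> [cpt a [prime_a a1] U Ua taua|red P].
  apply: contrapT => noV.
  have : (\cinf_(F in U) tau F) `&` cover_inf U <= a.
    apply: (le_trans (cpt U)); apply: csup_le => _ [V fV <-].
    by apply: contrapT => /negP Va; apply: noV; exists V.
  by move=> /prime_a[]; exact/negP.
apply: contrapT => /negP/nle_prime[p [Pp supp nle]].
have [| |V fV] := red p Pp P.
- by apply: contra nle => /(le_trans _); apply; exact: leIr.
- by apply: contra nle => /(le_trans _); apply; exact: leIl.
by move=> /negP; apply; apply: le_trans supp; apply: csup_ub; exists V.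
Qed.

Definition Q_cover_reduction (W : L -> set (X -> L) -> Prop) : Prop :=
  forall a, ML a -> forall b, beta_star a b -> forall U, Q_cover a G U ->
    (forall F, U F -> a <= tau F) ->
    exists2 V, finite_subfamilies U V & W b V.

Lemma Q_coverE a U : Q_cover a G U <-> a <= cover_inf U.
Proof.
split=> [Ua|aU x]; first by apply: cinf_ge => _ [x _ <-]; exact: Ua.
by apply: (le_trans aU); apply: cinf_lb; exists x.
Qed.

Lemma strong_beta_coverW a U : strong_beta_cover a G U -> beta_cover a G U.
Proof.
by move=> aU x; apply: (below_le_trans aU); apply: cinf_lb; exists x.
Qed.

Lemma beta_coverW a U : beta_cover a G U -> Q_cover a G U.
Proof. by move=> aU x; exact: below_le (aU x). Qed.

(** Since [b ≪ a], a join over finite subfamilies that lies above [a] has a single term above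
    [b]. *)
Lemma compact_Q_cover_reduction :
  compact_for -> Q_cover_reduction (fun b => Q_cover b G).
Proof.
move=> cpt a _ b [ba _] U /Q_coverE aU taua.
have [|_ [V fV <-] bV] := ba [set cover_inf Q | Q in finite_subfamilies U].
  apply: le_trans (cpt U); rewrite lexI aU andbT.
  by apply: cinf_ge => _ [F UF <-]; exact: taua.
by exists V => //; exact/Q_coverE.
Qed.

Lemma Q_cover_reduction_strong :
  Q_cover_reduction (fun b => Q_cover b G) ->
  Q_cover_reduction (fun b => strong_beta_cover b G).
Proof.
(* Using the reduction at an intermediate [e] with [b ≪ e] turns [e <= cover_inf V] into a
   well-below relation for [b]. *)
move=> red a Ma b [/beta_star_interpolation[e ae be] _] U aU taua.
have [V fV /Q_coverE eV] := red a Ma e ae U aU taua.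
by exists V => //; exact: below_le_trans eV.
Qed.

Lemma Q_cover_reduction_sub (W W' : L -> set (X -> L) -> Prop) :
  (forall a V, W a V -> W' a V) -> Q_cover_reduction W -> Q_cover_reduction W'.
Proof.
move=> WW' red a Ma b ab U Ua taua; have [V fV WV] := red a Ma b ab U Ua taua.
by exists V => //; exact: WW'.
Qed.

(** For a coprime [a] well below the left side, [P] satisfies the hypotheses at [a], so every [b] in
    [beta_star a] is below the right side. Such [b] join to [a], and such [a] to the left side. *)
Lemma Q_cover_reduction_compact :
  Q_cover_reduction (fun b => Q_cover b G) -> compact_for.
Proof.
move=> red P; apply: beta_star_le => a [/below_le].
rewrite lexI => /andP[tauP aP] Ma; apply: beta_star_le => b ab.
have [||V fV /Q_coverE bV] := red a Ma b ab P.
- exact/Q_coverE.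
- by move=> F PF; apply: (le_trans tauP); apply: cinf_lb; exists F.
by apply: (le_trans bV); apply: csup_ub; exists V.
Qed.

Lemma remote_reductionE :
  remote_reduction (fun a => remote_family a G) <->
  shading_reduction (fun a => shading a G).
Proof. by apply: remote_shading_reduction; exact: remote_shading. Qed.

Lemma strong_remote_reductionE :
  remote_reduction (fun a => strong_remote_family a G) <->
  shading_reduction (fun a => strong_shading a G).
Proof. by apply: remote_shading_reduction; exact: strong_remote_shading. Qed.

(** The auxiliary [b] moves to [neg b], which exchanges [beta_star] and [alpha_star]. *)
Lemma beta_star_remote_reduction (W W' : L -> set (X -> L) -> Prop) :
  (forall a P, W a P <-> W' (neg a) (neg @` P)) ->
  remote_reduction (fun a H => exists2 b, beta_star a b & W b H) <->
  shading_reduction (fun a V => exists2 b, alpha_star a b & W' b V).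
Proof.
move=> WW'; apply: remote_shading_reduction => a P; split=> -[b ab Wb].
  by exists (neg b); [exact/alpha_star_neg | exact/WW'].
exists (neg b); first by apply/alpha_star_neg; rewrite negK.
by apply/WW'; rewrite negK.
Qed.

Lemma beta_remote_reductionE :
  remote_reduction (fun a H => exists2 b, beta_star a b & remote_family b G H) <->
  shading_reduction (fun a V => exists2 b, alpha_star a b & shading b G V).
Proof. by apply: beta_star_remote_reduction; exact: remote_shading. Qed.

Lemma beta_strong_remote_reductionE :
  remote_reduction
    (fun a H => exists2 b, beta_star a b & strong_remote_family b G H) <->
  shading_reduction
    (fun a V => exists2 b, alpha_star a b & strong_shading b G V).
Proof. by apply: beta_star_remote_reduction; exact: strong_remote_shading. Qed.

Lemma shading_reductionW :
  shading_reduction (fun a => strong_shading a G) ->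
  shading_reduction (fun a => shading a G).
Proof. by apply: shading_reduction_sub => a V; exact: strong_shadingW. Qed.

Lemma shading_reduction_alphaW :
  shading_reduction
    (fun a V => exists2 b, alpha_star a b & strong_shading b G V) ->
  shading_reduction (fun a V => exists2 b, alpha_star a b & shading b G V).
Proof.
by apply: shading_reduction_sub => a V [b ab /strong_shadingW bV]; exists b.
Qed.

End Shadings.

Theorem theorem4p2 (d : Order.disp_t) (L : cdDeMorganType d) (X : Type)
    (X_nonempty : inhabited X) (T : (X -> L) -> L) (T_top : fuzzy_topology T)
    (G : X -> L) :
  [<-> (* (1) *)
       SP_compact T G;
       (* (2) *)
       forall a : L, ML a -> forall P : set (X -> L),
         strong_remote_family a G P ->
         ~~ (\cinf_(F in P) semi_preclosed T F <= neg a) ->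
         exists2 H : set (X -> L), finite_subfamilies P H & remote_family a G H;
       (* (2), strong *)
       forall a : L, ML a -> forall P : set (X -> L),
         strong_remote_family a G P ->
         ~~ (\cinf_(F in P) semi_preclosed T F <= neg a) ->
         exists2 H : set (X -> L), finite_subfamilies P H & strong_remote_family a G H;
       (* (3) *)
       forall a : L, ML a -> forall P : set (X -> L),
         strong_remote_family a G P ->
         ~~ (\cinf_(F in P) semi_preclosed T F <= neg a) ->
         exists2 H : set (X -> L), finite_subfamilies P H &
           exists2 b : L, beta_star a b & remote_family b G H;
       (* (3), strong *)
       forall a : L, ML a -> forall P : set (X -> L),
         strong_remote_family a G P ->
         ~~ (\cinf_(F in P) semi_preclosed T F <= neg a) ->
         exists2 H : set (X -> L), finite_subfamilies P H &
           exists2 b : L, beta_star a b & strong_remote_family b G H;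
       (* (4) *)
       forall a : L, PL a -> forall U : set (X -> L),
         strong_shading a G U ->
         ~~ (\cinf_(F in U) semi_preopen T F <= a) ->
         exists2 V : set (X -> L), finite_subfamilies U V & shading a G V;
       (* (4), strong *)
       forall a : L, PL a -> forall U : set (X -> L),
         strong_shading a G U ->
         ~~ (\cinf_(F in U) semi_preopen T F <= a) ->
         exists2 V : set (X -> L), finite_subfamilies U V & strong_shading a G V;
       (* (5) *)
       forall a : L, PL a -> forall U : set (X -> L),
         strong_shading a G U ->
         ~~ (\cinf_(F in U) semi_preopen T F <= a) ->
         exists2 V : set (X -> L), finite_subfamilies U V &
           exists2 b : L, alpha_star a b & shading b G V;
       (* (5), strong *)
       forall a : L, PL a -> forall U : set (X -> L),
         strong_shading a G U ->
         ~~ (\cinf_(F in U) semi_preopen T F <= a) ->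
         exists2 V : set (X -> L), finite_subfamilies U V &
           exists2 b : L, alpha_star a b & strong_shading b G V;
       (* (6) *)
       forall a : L, ML a -> forall b : L, beta_star a b ->
       forall U : set (X -> L),
         Q_cover a G U ->
         (forall F, U F -> a <= semi_preopen T F) ->
         exists2 V : set (X -> L), finite_subfamilies U V & Q_cover b G V;
       (* (7) *)
       forall a : L, ML a -> forall b : L, beta_star a b ->
       forall U : set (X -> L),
         Q_cover a G U ->
         (forall F, U F -> a <= semi_preopen T F) ->
         exists2 V : set (X -> L), finite_subfamilies U V & beta_cover b G V;
       (* (7), strong *)
       forall a : L, ML a -> forall b : L, beta_star a b ->
       forall U : set (X -> L),
         Q_cover a G U ->
         (forall F, U F -> a <= semi_preopen T F) ->
         exists2 V : set (X -> L), finite_subfamilies U V & strong_beta_cover b G V].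
Proof.
(* The implications form one cycle in the listed order. Remote conditions are first translated to
   shadings. *)
tfae.
- by move=> /compact_shading_reduction/shading_reductionW/remote_reductionE.
- by move=> /remote_reductionE/shading_reduction_strong/strong_remote_reductionE.
- move=> /strong_remote_reductionE/shading_reduction_alpha.
  by move=> /shading_reduction_alphaW/beta_remote_reductionE.
- move=> /beta_remote_reductionE/shading_reduction_alpha_strong/shading_reduction_alpha.
  by move=> /beta_strong_remote_reductionE.
- move=> /beta_strong_remote_reductionE/shading_reduction_alphaW.
  by move=> /shading_reduction_alpha_strong/shading_reductionW.
- exact: shading_reduction_strong.
- by move=> /shading_reduction_alpha/shading_reduction_alphaW.
- by move=> /shading_reduction_alpha_strong/shading_reduction_alpha.
(* Shadings and covers are linked through the inequality [compact_for]. *)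
- move=> /shading_reduction_alphaW/shading_reduction_alpha_strong.
  by move=> /compact_shading_reduction/compact_Q_cover_reduction.
- move=> /Q_cover_reduction_strong; apply: Q_cover_reduction_sub => a V.
  exact: strong_beta_coverW.
- move=> red; apply: Q_cover_reduction_strong; move: red.
  by apply: Q_cover_reduction_sub => a V; exact: beta_coverW.
- move=> red; apply: Q_cover_reduction_compact; move: red.
  apply: Q_cover_reduction_sub => a V /strong_beta_coverW.
  exact: beta_coverW.
Qed.
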